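(* There exist a mean-payoff game $\mathcal{G}$, a vertex $v$ of $\mathcal{G}$, and $\epsilon>0$ such that Player 0 needs an infinite memory strategy to achieve $\mathsf{ASV}^{\epsilon}(v)$; that is, $\mathsf{ASV}^{\epsilon}(\sigma_0)(v)=\mathsf{ASV}^{\epsilon}(v)$ for some strategy $\sigma_0$ of Player 0, but for no finite memory strategy $\sigma_0$ of Player 0.
   Context: An arena $(V,E,\langle V_0,V_1\rangle,w_0,w_1)$ consists of a finite set $V$ of vertices, a set $E\subseteq V\times V$ of edges such that every vertex has at least one successor, a partition of $V$ into $V_0$ (Player 0) and $V_1$ (Player 1), and weight functions $w_0,w_1:E\to\mathbb{Z}$. A mean-payoff game $\mathcal{G}$ is played on such an arena. A play is an infinite path $\pi=\pi_0\pi_1\dots$; a history is a nonempty finite prefix of a play. The payoff of Player $i\in\{0,1\}$ is $\underline{\mathsf{MP}}_i(\pi)=\liminf_{k\to\infty}\frac1k w_i(\pi_0\dots\pi_k)$, where $w_i$ of a history is the sum of the $w_i$-weights of its edges. A strategy of Player $i$ maps each history ending in a vertex of $V_i$ to a successor of that last vertex; $\Sigma_i$ is the set of strategies of Player $i$. $\mathsf{Out}_v(\sigma_0,\sigma_1)$ is the unique play from $v$ consistent with $\sigma_0$ and $\sigma_1$. A strategy is finite memory if it can be realized as the output of a state machine with finitely many states, and infinite memory otherwise. For $\epsilon>0$, $\mathsf{BR}^{\epsilon}_{1}(\sigma_0)$ is the set of $\sigma_1\in\Sigma_1$ such that for all $v\in V$ and all $\sigma_1'\in\Sigma_1$: $\underline{\mathsf{MP}}_1(\mathsf{Out}_v(\sigma_0,\sigma_1))>\underline{\mathsf{MP}}_1(\mathsf{Out}_v(\sigma_0,\sigma_1'))-\epsilon$.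 Then $\mathsf{ASV}^{\epsilon}(\sigma_0)(v)=\inf_{\sigma_1\in\mathsf{BR}^{\epsilon}_1(\sigma_0)}\underline{\mathsf{MP}}_0(\mathsf{Out}_v(\sigma_0,\sigma_1))$ and $\mathsf{ASV}^{\epsilon}(v)=\sup_{\sigma_0\in\Sigma_0}\mathsf{ASV}^{\epsilon}(\sigma_0)(v)$. *)

(* Defs.v *)
From HB Require Import structures.
From mathcomp Require Import all_boot all_order all_algebra.
From mathcomp Require Import all_classical all_reals all_analysis.

Set Implicit Arguments.
Unset Strict Implicit.
Unset Printing Implicit Defensive.

Import Order.TTheory GRing.Theory Num.Theory.

Local Open Scope classical_set_scope.
Local Open Scope ring_scope.

Variant player := P0 | P1.

(* The partition of the vertices is given by [owner].  The weights are total
   functions on pairs of vertices; only their values on edges are ever used. *)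
Record arena := Arena {
  vertex :> finType;
  edge : rel vertex;
  edge_total : forall u, exists u', edge u u';
  owner : vertex -> player;
  weight : player -> vertex -> vertex -> int
}.

(* A history is a nonempty sequence [x :: h] with [path (@edge G) x h]; its
   last vertex is [last x h].  The values of [act] on arguments that are not
   histories ending in a vertex of Player [i] are junk: nothing below depends
   on them. *)
Record strategy (G : arena) (i : player) := Strategy {
  act :> G -> seq G -> G;
  act_edge : forall x h, path (@edge G) x h -> owner (last x h) = i ->
    edge (last x h) (act x h)
}.

(* Mealy machine: the current vertex is the input letter, and the state is the
   one reached after reading all the earlier vertices of the history. *)
Definition finite_memory (G : arena) (i : player) (s : strategy G i) : Prop :=
  exists (M : finType) (m0 : M) (upd : M -> G -> M) (out : M -> G -> G),
  forall x h, path (@edge G) x h -> owner (last x h) = i ->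
    s x h = out (foldl upd m0 (belast x h)) (last x h).

Section Outcome.
Variables (G : arena) (s0 : strategy G P0) (s1 : strategy G P1).

Definition next_vertex (x : G) (h : seq G) : G :=
  match owner (last x h) with P0 => s0 x h | P1 => s1 x h end.

(* [v :: outcome_history v k] is the prefix with k edges of the outcome. *)
Fixpoint outcome_history (v : G) (k : nat) : seq G :=
  if k is k'.+1 then
    let h := outcome_history v k' in rcons h (next_vertex v h)
  else [::].

Definition outcome (v : G) (k : nat) : G := last v (outcome_history v k).

End Outcome.

Section Values.
Variables (R : realType) (G : arena).

(* The term of index k = 0 is 0 by convention and does not affect the limit. *)
Definition mean_payoff (i : player) (p : nat -> G) : \bar R :=
  limn_einf (fun k : nat =>
    (k%:R^-1 * (\sum_(j < k) weight i (p j) (p j.+1))%:~R)%:E).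

Definition best_response (eps : R) (s0 : strategy G P0) :
    set (strategy G P1) :=
  [set s1 | forall (v : G) (s1' : strategy G P1),
    (mean_payoff P1 (outcome s0 s1 v) >
     mean_payoff P1 (outcome s0 s1' v) - eps%:E)%E].

Definition ASV_strategy (eps : R) (s0 : strategy G P0) (v : G) : \bar R :=
  ereal_inf [set mean_payoff P0 (outcome s0 s1 v) |
             s1 in best_response eps s0].

Definition ASV (eps : R) (v : G) : \bar R :=
  ereal_sup [set ASV_strategy eps s0 v | s0 in [set: strategy G P0]].

End Values.

(* Main.v *)
Require Import Defs.
From HB Require Import structures.
From mathcomp Require Import all_boot all_order all_algebra.
From mathcomp Require Import all_classical all_reals all_analysis.
From mathcomp Require Import zify ring lra.

Set Implicit Arguments.
Unset Strict Implicit.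
Unset Printing Implicit Defensive.

Import Order.TTheory GRing.Theory Num.Theory.

Local Open Scope classical_set_scope.
Local Open Scope ring_scope.

(** A vertex [start] of Player 1 leads either to an absorbing [sink] with payoffs
    (0, 0) or to a complete digraph with loops on two hubs owned by Player 0.
    The only nonzero weights are on the two loops: (1, 0) on [hub true] and
    (0, 1) on [hub false].  With eps = 1/2, leaving for the sink is an
    eps-best response exactly when entering pays Player 1 less than 1/2, so
    Player 0 maximizes her own payoff among the plays on the hubs that pay
    Player 1 at least 1/2.  Since every edge pays at most 1 in total, she gets at
    most 1/2.  Staying on the hubs alternately, in blocks of linearly growing
    length, achieves 1/2, because switching then has frequency 0.  A finite-memory
    strategy yields an ultimately periodic play: if both payoffs were at least
    1/2 then no edge of the period would be a switch, so the play would stay on one hub and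
    pay 0 to one of the players. *)

(** * Lower asymptotic densities of counting functions *)

Section Frequency.
Variable R : realType.
Implicit Types (N : nat -> nat) (x y : R).

Definition lower_density N : \bar R :=
  limn_einf (fun k : nat => (k%:R^-1 * (N k)%:R)%:E).

Lemma limn_einf_ge (a : \bar R) (u : (\bar R)^nat) :
  (\forall k \near \oo, (a <= u k)%E) -> (a <= limn_einf u)%E.
Proof.
case=> n _ a_le; rewrite limn_einf_lim (cvg_lim _ (@cvg_einfs_sup R u)) //.
apply: (@le_trans _ _ (einfs u n)); last by apply: ereal_sup_ubound; exists n.
by apply: le_ereal_inf_tmp => _ [k /= le_nk <-]; exact: a_le.
Qed.

Lemma limn_einf_gt (a : \bar R) (u : (\bar R)^nat) :
  (a < limn_einf u)%E -> \forall k \near \oo, (a < u k)%E.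
Proof.
rewrite limn_einf_lim (cvg_lim _ (@cvg_einfs_sup R u)) //.
move=> /ereal_sup_gt[_ [n _ <-] a_lt]; exists n => // k /= le_nk.
by apply: (lt_le_trans a_lt); apply: ereal_inf_lbound; exists k.
Qed.

(** Clearing the denominator reduces liminf bounds to polynomial inequalities at large [k]. *)
Lemma lower_density_geP N x :
  (x%:E <= lower_density N)%E <->
  forall d, 0 < d -> \forall k \near \oo, (x - d) * k%:R <= (N k)%:R.
Proof.
split=> [le_x d d0 | ge_x].
  have : ((x - d)%:E < lower_density N)%E.
    by apply: lt_le_trans le_x; rewrite lte_fin; lra.
  move=> /limn_einf_gt; apply: filterS => -[|k]; first by rewrite mulr0.
  by rewrite lte_fin mulrC ltr_pdivlMr ?ltr0n// => /ltW.
apply/lee_subgt0Pr => d d0; rewrite -EFinD.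
apply: limn_einf_ge; near=> k.
rewrite lee_fin mulrC ler_pdivlMr; last by rewrite ltr0n; near: k; exists 1%N.
by near: k; exact: ge_x.
Unshelve. all: by end_near. Qed.

Lemma lower_density_le N y :
  (forall x, (x%:E <= lower_density N)%E -> x <= y) ->
  (lower_density N <= y%:E)%E.
Proof.
case: (lower_density N) => [r| |] le_y; last by rewrite leNye.
  by rewrite lee_fin le_y.
by have := le_y (y + 1); rewrite leey gerDl ler10 => /(_ isT).
Qed.

Lemma lower_density_ge0 N : (0 <= lower_density N)%E.
Proof.
apply/lower_density_geP => d d0; apply: nearW => k.
by rewrite (@le_trans _ _ 0)// mulr_le0_ge0//; lra.
Qed.

(** Both lower bounds hold at a common large [k], where the counts add up to at most [k]. *)
Lemma lower_density_le_compl N N' x : (forall k, N k + N' k <= k)%N ->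
  (x%:E <= lower_density N')%E -> (lower_density N <= (1 - x)%:E)%E.
Proof.
move=> le_k /lower_density_geP x_le; apply: lower_density_le => y.
move=> /lower_density_geP y_le; apply/ler_addgt0Pr => e e0.
have e20 : 0 < e / 2 by lra.
have [k [/= k0 lex ley]] : exists k : nat, [/\ (0 < k)%N,
    (x - e / 2) * k%:R <= (N' k)%:R & (y - e / 2) * k%:R <= (N k)%:R].
  near \oo => k; exists k; split; near: k; first by exists 1%N.
  - exact: x_le.
  - exact: y_le.
have : (N k)%:R + (N' k)%:R <= k%:R :> R by rewrite -natrD ler_nat.
have : (0 < k%:R :> R) by rewrite ltr0n.
nra.
Unshelve. all: by end_near. Qed.

Lemma lower_density_le1 N : (forall k, N k <= k)%N ->
  (lower_density N <= 1%:E)%E.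
Proof.
move=> le_k; rewrite -[1]subr0.
apply: (@lower_density_le_compl _ (fun=> 0%N)); last exact: lower_density_ge0.
by move=> k; rewrite addn0.
Qed.

Lemma lower_density_fin N : (forall k, N k <= k)%N ->
  lower_density N \is a fin_num.
Proof.
move=> /lower_density_le1 le1; rewrite fin_numE.
have ge0 := lower_density_ge0 N.
by apply/andP; split; apply/eqP => E; move: ge0 le1; rewrite E.
Qed.

Lemma lower_density0 : lower_density (fun=> 0%N) = 0%E.
Proof.
apply/eqP; rewrite eq_le lower_density_ge0 andbT.
rewrite -[leRHS]/(0%:E) -(subrr 1); apply: (@lower_density_le_compl _ id) => //.
apply/lower_density_geP => d d0; apply: nearW => k.
by have := ler0n R k; nra.
Qed.

(** Along the times [i + n * L] the frequency tends to [a / L], which therefore bounds the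
    liminf. *)
Lemma lower_density_arith N x i L a : (0 < L)%N ->
  (forall n, N (i + n * L) = N i + n * a)%N ->
  (x%:E <= lower_density N)%E -> x * L%:R <= a%:R.
Proof.
move=> L0 NE /lower_density_geP x_le; rewrite leNgt; apply/negP => lt_a.
have LR0 : 0 < L%:R :> R by rewrite ltr0n.
(* With slack [c / L], half of the assumed gap, the required count still outgrows the actual one by
   [c] per period. *)
pose c := (x * L%:R - a%:R) / 2; have c0 : 0 < c by rewrite /c; lra.
have [K _ Kx] := x_le (c / L%:R) (divr_gt0 c0 LR0).
near \oo => n.
have /Kx : (K <= i + n * L)%N.
  apply: (@leq_trans n); first by near: n; exists K.
  by rewrite (leq_trans (leq_pmulr n L0))// leq_addl.
rewrite NE !natrD !natrM => {}Kx.
have : ((N i)%:R - (x - c / L%:R) * i%:R) / c < n%:R.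
  by near: n; exact: nbhs_infty_gtr.
rewrite ltr_pdivrMr// => lt_n.
have cL : c / L%:R * L%:R = c by rewrite divfK// gt_eqF.
have aE : a%:R = x * L%:R - 2 * c by rewrite /c; field.
have : (x - c / L%:R) * (n%:R * L%:R) = n%:R * (x * L%:R - c).
  by rewrite -[in RHS]cL; ring.
move: Kx lt_n; rewrite aE; lra.
Unshelve. all: by end_near. Qed.

Lemma sum_periodic (u : nat -> nat) i L :
  (forall k, i <= k -> u (k + L) = u k)%N -> forall n,
  (\sum_(j < i + n * L) u j = \sum_(j < i) u j + n * \sum_(j < L) u (i + j))%N.
Proof.
move=> perL; elim=> [|n IHn]; first by rewrite !mul0n !addn0.
rewrite [in LHS]mulSnr addnA big_split_ord IHn /= mulSnr addnA; congr (_ + _)%N.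
apply: eq_bigr => j _; elim: n {IHn} => [|n <-]; first by rewrite mul0n addn0.
by rewrite mulSnr addnA addnAC perL//; lia.
Qed.

End Frequency.

(** * The game graph and its plays *)

Section Arena.

Let vert : finType := option (option bool).
Let start : vert := None.
Let sink : vert := Some None.
Let hub (c : bool) : vert := Some (Some c).

Definition home (i : player) : vert := hub (if i is P0 then true else false).

Definition loop i (x y : vert) := (x == home i) && (y == home i).

Lemma loop_exclusive x y : (loop P0 x y + loop P1 x y <= 1)%N.
Proof. by case: x y => [[[]|]|] [[[]|]|]. Qed.

(** The middle vertex is [home i], and the only loop there is that of Player [i]. *)
Lemma loop_chain i x y z : loop i x y ->
  (loop P0 y z + loop P1 y z = 1)%N -> loop i y z.
Proof. by case: i x y z => [] [[[]|]|] [[[]|]|] [[[]|]|]. Qed.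

Definition tradeoff_edge : rel vert := fun x y =>
  match x with
  | None => (y == sink) || (y == hub true)
  | Some None => y == sink
  | Some (Some _) => (y == hub true) || (y == hub false)
  end.

Lemma tradeoff_edge_total x : exists y, tradeoff_edge x y.
Proof. by case: x => [[c|]|]; [exists (hub true)|exists sink|exists sink]. Qed.

Definition tradeoff : arena := @Arena vert tradeoff_edge tradeoff_edge_total
  (fun x => if x is None then P1 else P0)
  (fun i x y => Posz (loop i x y)).

Implicit Types (s : strategy tradeoff P0) (t : strategy tradeoff P1).
Implicit Types (i : player) (p : nat -> tradeoff) (x y : tradeoff).

Lemma edge_neq_start x y : edge x y -> y != start.
Proof. by case: x y => [[c|]|] [[c'|]|]. Qed.

Lemma last_path_start x (h : seq tradeoff) :
  path (@edge tradeoff) x h -> last x h = start -> x = start /\ h = [::].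
Proof.
elim/last_ind: h => [//|h y _]; rewrite rcons_path last_rcons.
by move=> /andP[_ /edge_neq_start/eqP].
Qed.

Lemma owner_P1 x : owner x = P1 -> x = start.
Proof. by case: x. Qed.

Lemma owner_P0 x : x != start -> owner x = P0.
Proof. by case: x. Qed.

Definition enter : strategy tradeoff P1.
Proof.
by exists (fun _ _ => hub true) => x h _ /owner_P1->.
Defined.

Definition exit : strategy tradeoff P1.
Proof.
by exists (fun _ _ => sink) => x h _ /owner_P1->.
Defined.

Lemma outcome_path s t x k :
  path (@edge tradeoff) x (outcome_history s t x k).
Proof.
elim: k => [//|k IHk] /=; rewrite rcons_path IHk /= /next_vertex.
by case E: (owner _); [exact: (@act_edge _ _ s)|exact: (@act_edge _ _ t)].
Qed.

Lemma outcome_historyS s t x k : outcome_history s t x k.+1 =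
  rcons (outcome_history s t x k) (outcome s t x k.+1).
Proof. by rewrite /outcome /= last_rcons. Qed.

Lemma outcome_edge s t x k :
  edge (outcome s t x k) (outcome s t x k.+1).
Proof.
have := outcome_path s t x k.+1.
by rewrite outcome_historyS rcons_path => /andP[].
Qed.

Lemma outcomeS_neq_start s t x k : outcome s t x k.+1 != start.
Proof. exact: edge_neq_start (outcome_edge _ _ _ _). Qed.

Lemma outcomeS s t x k : outcome s t x k != start ->
  outcome s t x k.+1 = s x (outcome_history s t x k).
Proof.
by move=> nstart; rewrite /outcome /= last_rcons /next_vertex owner_P0.
Qed.

(* [start] has no incoming edge, so Player 1 moves at most once. *)
Lemma eq_outcome s t t' x :
  (x = start -> t start [::] = t' start [::]) ->
  outcome s t x = outcome s t' x.
Proof.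
move=> eq_s; apply/funext => k; rewrite /outcome; congr last.
elim: k => [//|k /= <-]; congr rcons; rewrite /next_vertex.
have hP := outcome_path s t x k; case E: (owner _) => //.
by have [xE ->] := last_path_start hP (owner_P1 E); rewrite xE eq_s.
Qed.

Lemma outcome_start s t :
  outcome s t start = outcome s enter start \/
  outcome s t start = outcome s exit start.
Proof.
have := @act_edge _ _ t start [::] isT erefl.
by case/orP=> /eqP E; [right|left]; apply: eq_outcome => _; rewrite E.
Qed.

Lemma outcome_exit s k : outcome s exit start k.+1 = sink.
Proof.
elim: k => [//|k IHk]; have := outcome_edge s exit start k.+1.
by rewrite IHk => /eqP.
Qed.

Definition loops i p k : nat :=
  (\sum_(j < k) loop i (p j) (p j.+1))%N.

Lemma loops_le p k : (loops P0 p k + loops P1 p k <= k)%N.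
Proof.
rewrite -big_split /= -[leqRHS]card_ord -sum1_card leq_sum// => j _.
exact: loop_exclusive.
Qed.

Lemma loops_le_id i p k : (loops i p k <= k)%N.
Proof.
by apply: leq_trans (loops_le p k); case: i; rewrite ?leq_addr ?leq_addl.
Qed.

(** * Payoffs as loop frequencies, and best responses *)

Section Payoff.
Variable R : realType.

Lemma mean_payoffE i p : mean_payoff R i p = lower_density R (loops i p).
Proof.
rewrite /mean_payoff; congr limn_einf; apply/funext => k.
by rewrite rmorph_sum natr_sum.
Qed.

Lemma mean_payoff_fin i p : mean_payoff R i p \is a fin_num.
Proof. by rewrite mean_payoffE lower_density_fin// => k; exact: loops_le_id. Qed.

Lemma mean_payoff_exit i s : mean_payoff R i (outcome s exit start) = 0%E.
Proof.
rewrite mean_payoffE -[RHS](lower_density0 R); congr (lower_density R _).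
apply/funext => k; rewrite /loops big1// => j _.
by rewrite outcome_exit /loop andbF.
Qed.

Let payoff i s : \bar R := mean_payoff R i (outcome s enter start).

(** Settles deviations that do not change the play; the strict inequality would fail at infinite
    values. *)
Lemma lt_sub_half (a : \bar R) : a \is a fin_num -> (a - (2^-1)%:E < a)%E.
Proof. by case: a => // r _; rewrite -EFinD lte_fin; lra. Qed.

Lemma enter_best_response s : ((2^-1)%:E <= payoff P1 s)%E ->
  best_response (2^-1 : R) s enter.
Proof.
move=> ge x t; case: (eqVneq x start) => [->|/eqP xs].
  case: (outcome_start s t) => ->; first exact/lt_sub_half/mean_payoff_fin.
  rewrite mean_payoff_exit; apply: lt_le_trans ge.
  by rewrite -EFinD lte_fin; lra.
by rewrite (@eq_outcome s t enter)//; exact/lt_sub_half/mean_payoff_fin.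
Qed.

Lemma exit_best_response s : (payoff P1 s < (2^-1)%:E)%E ->
  best_response (2^-1 : R) s exit.
Proof.
move=> lt x t; case: (eqVneq x start) => [->|/eqP xs].
  case: (outcome_start s t) => ->; last exact/lt_sub_half/mean_payoff_fin.
  rewrite mean_payoff_exit; move: lt (mean_payoff_fin P1 (outcome s enter start)).
  rewrite /payoff; case: mean_payoff => // r.
  by rewrite -EFinD !lte_fin => ? _; lra.
by rewrite (@eq_outcome s t exit)//; exact/lt_sub_half/mean_payoff_fin.
Qed.

(** One of [enter] and [exit] is a best response, depending on the threshold, and its payoff bounds
    the infimum. *)
Lemma ASV_strategy_le s :
  (ASV_strategy (2^-1 : R) s start <=
     if ((2^-1)%:E <= payoff P1 s)%E then payoff P0 s else 0)%E.
Proof.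
case: (leP (2^-1)%:E (payoff _ _)) => [ge|lt]; apply: ereal_inf_lbound.
  by exists enter => //; exact: enter_best_response.
by exists exit; [exact: exit_best_response|rewrite mean_payoff_exit].
Qed.

(** Leaving pays Player 1 exactly 0, which is not above her entering payoff minus 1/2, so every best
    response enters. *)
Lemma ASV_strategy_ge s :
  ((2^-1)%:E <= payoff P1 s)%E -> (payoff P0 s <= ASV_strategy (2^-1 : R) s start)%E.
Proof.
move=> ge; apply: le_ereal_inf_tmp => _ [t BR <-].
case: (outcome_start s t) => E; first by rewrite E.
exfalso; have := BR start enter; rewrite E mean_payoff_exit.
move: ge; rewrite /payoff; case: mean_payoff => [r| |] //.
by rewrite lee_fin -EFinD lte_fin; lra.
Qed.

Lemma ASV_le : (ASV (2^-1 : R) (start : tradeoff) <= (2^-1)%:E)%E.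
Proof.
apply: ge_ereal_sup => _ [s _ <-].
apply: le_trans (ASV_strategy_le s) _.
case: ifP => [ge|_]; last by rewrite lee_fin; lra.
have -> : 2^-1 = 1 - 2^-1 :> R by field.
rewrite /payoff mean_payoffE; apply: lower_density_le_compl.
  exact: (loops_le (outcome s enter start)).
by rewrite -mean_payoffE.
Qed.

End Payoff.

(** * Finite memory and ultimately periodic plays *)

Section FiniteMemory.

(** The pair of memory state and current vertex evolves deterministically in a finite set. *)
Lemma finite_memory_periodic s t : finite_memory s ->
  exists n0 L, (0 < L)%N /\ forall k, (n0 <= k)%N ->
    outcome s t start (k + L) = outcome s t start k.
Proof.
move=> [M [m0 [upd [out outE]]]].
pose hist k := outcome_history s t start k.
pose q k : M * tradeoff :=
  (foldl upd m0 (belast start (hist k)), outcome s t start k).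
pose step (a : M * tradeoff) := (upd a.1 a.2, out a.1 a.2).
(* Time 0 is excluded: Player 1 moves there. Hence the orbit starts at [q 1] and the preperiod is
   [n0.+1]. *)
have qS k : q k.+2 = step (q k.+1).
  rewrite /q /step /=; congr pair.
    rewrite -/(hist k.+1) [hist k.+2]outcome_historyS belast_rcons -/(hist k.+1).
    by rewrite [start :: _]lastI -cats1 foldl_cat.
  rewrite outcomeS ?outcomeS_neq_start// outE//.
    exact: outcome_path.
  by rewrite owner_P0//; exact: (outcomeS_neq_start s t start k).
have q_iter k : q k.+1 = iter k step (q 1%N) by elim: k => //= k <-.
have /trajectP[n0 lt_i iE] := looping_order step (q 1%N).
set n := fingraph.order _ _ in lt_i iE.
exists n0.+1, (n - n0)%N; split=> [|k le_k]; first by rewrite subn_gt0.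
have -> : (k + (n - n0) = (k - n0.+1 + n).+1)%N by lia.
rewrite -[LHS]/((q _).2) q_iter iterD iE -iterD -q_iter.
by rewrite -[RHS]/((q _).2); congr (q _).2; lia.
Qed.

Lemma periodic_payoffs (R : realType) p n0 L : (0 < L)%N ->
  (forall k, n0 <= k -> p (k + L) = p k)%N ->
  ((2^-1)%:E <= mean_payoff R P1 p)%E -> (mean_payoff R P0 p < (2^-1)%:E)%E.
Proof.
move=> L0 perL ge1; rewrite ltNge; apply/negP => ge0.
pose u z k := loop z (p k) (p k.+1).
pose a z := (\sum_(j < L) u z (n0 + j))%N.
have half z : ((2^-1)%:E <= mean_payoff R z p)%E -> (L <= 2 * a z)%N.
  rewrite mean_payoffE => /(lower_density_arith L0 (i := n0) (a := a z)) H.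
  rewrite -(ler_nat R) natrM; suff : 2^-1 * L%:R <= (a z)%:R :> R by lra.
  apply: H => n; apply: (@sum_periodic (u z)) => k le_k.
  by rewrite /u -addSn !perL// ltnW.
have {ge0} a0 := half _ ge0; have {ge1 half} a1 := half _ ge1.
have uD k : (u P0 k + u P1 k <= 1)%N.
  exact: loop_exclusive.
(* The two counts total at least [L], leaving no room for a step without a loop. *)
have all1 (j : 'I_L) : (u P0 (n0 + j) + u P1 (n0 + j) = 1)%N.
  apply/eqP; rewrite eqn_leq uD /= leqNgt; apply/negP => lt1.
  have : (a P0 + a P1 < L)%N; last by lia.
  rewrite -big_split /= -[ltnRHS]card_ord -sum1_card.
  rewrite (bigD1 j)//= [ltnRHS](bigD1 j)//= -addSn leq_add//.
  by apply: leq_sum.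
have const z j : (j < L)%N -> u z n0 -> u z (n0 + j)%N.
  elim: j => [|j IHj] ltj uz; first by rewrite addn0.
  have := all1 (Ordinal ltj); rewrite /= /u addnS.
  by apply: loop_chain; exact: IHj (ltnW ltj) uz.
have a_all z : u z n0 -> a z = L.
  move=> uz; rewrite /a -[RHS]card_ord -sum1_card; apply: eq_bigr => j _.
  by rewrite const.
have := all1 (Ordinal L0); rewrite /= addn0.
have : (a P0 + a P1 <= L)%N.
  by rewrite -big_split /= -[leqRHS]card_ord -sum1_card leq_sum.
(* Whoever owns the first loop of the period has count [L], so the other count is 0, below
   [L / 2]. *)
case u0 : (u P0 n0 : bool); first by have := a_all P0; rewrite u0; lia.
case u1 : (u P1 n0 : bool); first by have := a_all P1; rewrite u1; lia.
by [].
Qed.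

End FiniteMemory.

(** * The alternating play *)

Section Blocks.

(* [block k] is the pair (m, r) such that time [k] is the [r]-th instant of the
   [m]-th block, which has length [2 * m + 1]. *)
Definition block_step (b : nat * nat) : nat * nat :=
  if (b.2 < b.1.*2)%N then (b.1, b.2.+1) else (b.1.+1, 0%N).

Definition block k := iter k block_step (0%N, 0%N).

Definition color k := ~~ odd (block k).1.

Definition monochromatic c k : nat :=
  (\sum_(j < k) ((color j == c) && (color j.+1 == c)))%N.

(** Block [j] starts at time [j ^ 2] and has [2 * j] inner steps. The last two bounds sum these over
    every other earlier block, plus [r] for the current color; their constants fit both parities of
    [m]. *)
Lemma monochromatic_block k (m := (block k).1) (r := (block k).2) :
  [/\ k = m ^ 2 + r, r <= 2 * m,
      m ^ 2 + 2 * r <= 2 * monochromatic (~~ odd m) k + 2 * m &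
      m ^ 2 <= 2 * monochromatic (odd m) k + 1]%N.
Proof.
rewrite {}/m {}/r; elim: k => [|k]; first by rewrite /monochromatic !big_ord0.
have monoS c : monochromatic c k.+1 =
    (monochromatic c k + ((color k == c) && (color k.+1 == c)))%N.
  by rewrite /monochromatic big_ord_recr.
rewrite !monoS /color [block k.+1]iterS -/(block k); case: (block k) => m r /=.
rewrite /block_step /=; case: ltnP => le_r /= [kE rm cur oth];
  rewrite ?eqxx ?negbK; case: (odd m) cur oth => /= cur oth; split; nia.
Qed.

(** Current or not, each color gets half of the steps up to an error of order [sqrt k]. *)
Lemma monochromatic_ge c k : exists2 m : nat, (m ^ 2 <= k)%N &
  (k <= 2 * monochromatic c k + 4 * m + 1)%N.
Proof.
have [kE rm cur oth] := monochromatic_block k; exists (block k).1; first lia.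
by move: c; case: (odd _) cur oth => /= cur oth []; lia.
Qed.

Definition alternate : strategy tradeoff P0.
Proof.
(* The length of the history serves as an unbounded clock. *)
exists (fun x h => if last x h == sink then sink else hub (color (size h))).
by move=> x h _; case: (last x h) => [[c|]|] //= _; case: color.
Defined.

Lemma size_outcome_history s t x k : size (outcome_history s t x k) = k.
Proof. by elim: k => //= k IHk; rewrite size_rcons IHk. Qed.

(** The shift by one is the move out of [start]; [enter] goes to [hub true], matching [color 0]. *)
Lemma outcome_alternate k :
  outcome alternate enter start k.+1 = hub (color k).
Proof.
elim: k => [//|k IHk]; rewrite outcomeS; last by rewrite IHk.
rewrite /= -/(outcome alternate enter start k.+1) IHk /=.
by rewrite size_rcons size_outcome_history.
Qed.

Lemma loops_alternate i k : loops i (outcome alternate enter start) k.+1 =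
  monochromatic (if i is P0 then true else false) k.
Proof.
rewrite /loops big_ord_recl add0n; apply: eq_bigr => j _.
by rewrite /loop !outcome_alternate.
Qed.

Lemma alternate_payoff (R : realType) i :
  ((2^-1)%:E <= mean_payoff R i (outcome alternate enter start))%E.
Proof.
rewrite mean_payoffE; apply/lower_density_geP => d d0; near=> k.
have k0 : (0 < k)%N by near: k; exists 1%N.
(* [4 / d] pays for the bound on [4 * a] below, and [2] for the additive constants. *)
have : 4 / d + 2 <= d * k%:R.
  by rewrite [leRHS]mulrC -ler_pdivrMr//; near: k; exact: nbhs_infty_ger.
rewrite -(prednK k0); move: k.-1 => n dk.
rewrite loops_alternate; set c := (if i is P0 then _ else _).
have [m mn] := monochromatic_ge c n.
move: mn dk; rewrite -!(ler_nat R) natrX -[n.+1]addn1 !natrD.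
move: (m%:R : R) (n%:R : R) ((monochromatic c n)%:R : R) => a b N mn dn nN.
(* The deficit of order 4 sqrt k is absorbed by d k through AM-GM. *)
have : 4 * a <= d * a ^+ 2 + 4 / d.
  have -> : d * a ^+ 2 + 4 / d = d * (a - 2 / d) ^+ 2 + 4 * a.
    by field; rewrite gt_eqF.
  by rewrite lerDr mulr_ge0 ?sqr_ge0 ?ltW.
have : d * a ^+ 2 <= d * b by rewrite ler_pM2l.
lra.
Unshelve. all: by end_near. Qed.

End Blocks.

(** * The value 1/2 and its attainment *)

Lemma tradeoff_infinite_memory (R : realType) (eps := 2^-1 : R)
    (v : tradeoff := start) :
  [/\ 0 < eps,
      exists s : strategy tradeoff P0, ASV_strategy eps s v = ASV eps v
    & forall s : strategy tradeoff P0,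
        finite_memory s -> ASV_strategy eps s v <> ASV eps v].
Proof.
have alternate_ge : (eps%:E <= ASV_strategy eps alternate v)%E.
  apply: le_trans (alternate_payoff R P0) _; apply: ASV_strategy_ge.
  exact: alternate_payoff.
have ASV_E : ASV eps v = eps%:E.
  apply/eqP; rewrite eq_le ASV_le; apply: le_trans alternate_ge _.
  by apply: ereal_sup_ubound; exists alternate.
rewrite ASV_E; split; first by rewrite /eps; lra.
  exists alternate; apply/eqP; rewrite eq_le alternate_ge andbT -ASV_E.
  by apply: ereal_sup_ubound; exists alternate.
move=> s /(finite_memory_periodic enter)[n [L [L0 perL]]].
apply/eqP; rewrite lt_eqF//; apply: le_lt_trans (ASV_strategy_le R s) _.
case: ifP => [|_]; first exact: periodic_payoffs perL.
by rewrite lte_fin /eps; lra.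
Qed.

End Arena.

Theorem theorem34 (R : realType) :
  exists (G : arena) (v : G) (eps : R),
    [/\ 0 < eps,
        exists s0 : strategy G P0, ASV_strategy eps s0 v = ASV eps v
      & forall s0 : strategy G P0,
          finite_memory s0 -> ASV_strategy eps s0 v <> ASV eps v].
Proof.
by exists tradeoff; do 2 eexists; exact: tradeoff_infinite_memory.
Qed.
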